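(* Let $a>0$. For $N>0$ and $n=0,1,2,\ldots$ let $C_n^{a,N}(x)$ be the generalized Charlier polynomials $$C_n^{a,N}(x)=\left[1+N(-1)^nC_n^{(a)}(-1)\right]C_n^{(a)}(x)-N(-1)^nC_n^{(a)}(0)\,C_n^{(a)}(x-1).$$ Let $(k_i)_{i\ge 0}$ be integers with $0\le k_i\le i$, and let $\{B_i(x)\}_{i=0}^{\infty}$ be coefficients, independent of $N$, such that $B_0(x)$ is independent of $x$ (but may depend on $n$) and the functions $B_i(x)$, $i\ge 1$, are independent of $n$. Suppose that for all $N>0$ and all $n=0,1,2,\ldots$ the polynomial $y(x)=C_n^{a,N}(x)$ satisfies $$N\sum_{i=0}^{\infty}B_i(x)\Delta^{k_i}\nabla^{i-k_i}y(x)+x\Delta\nabla y(x)+(a-x)\Delta y(x)+ny(x)=0$$ for all real $x$. Then this difference equation has infinite order, i.e. $B_i$ is not identically zero for infinitely many $i$.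
   Context: The classical Charlier polynomials are $$C_n^{(a)}(x):=\sum_{k=0}^n\binom{x}{k}\frac{(-a)^{n-k}}{(n-k)!},\qquad n=0,1,2,\ldots,$$ where $\binom{x}{k}=x(x-1)\cdots(x-k+1)/k!$, so that $C_n^{(a)}$ is a polynomial in $x$ and may be evaluated at any real $x$. The difference operators are $\Delta f(x):=f(x+1)-f(x)$ and $\nabla f(x):=f(x)-f(x-1)$; powers denote iterates, with zeroth power the identity. Since $y$ is a polynomial, only finitely many terms of the infinite sum are nonzero. For $a>0$, $N>0$ the polynomials $C_n^{a,N}$ are orthogonal with respect to $\langle f,g\rangle=\sum_{x=0}^{\infty}\frac{e^{-a}a^x}{x!}f(x)g(x)+Nf(0)g(0)$. *)

(* Defs.v *)
From mathcomp Require Import all_boot all_order all_algebra.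
From mathcomp Require Import all_classical all_reals all_analysis.

Set Implicit Arguments.
Unset Strict Implicit.
Unset Printing Implicit Defensive.

Import Order.TTheory GRing.Theory Num.Theory numFieldNormedType.Exports.
Local Open Scope classical_set_scope.
Local Open Scope ring_scope.

Definition rbinom (R : realType) (x : R) (k : nat) : R :=
  (\prod_(j < k) (x - j%:R)) / k`!%:R.

Definition charlier (R : realType) (a : R) (n : nat) (x : R) : R :=
  \sum_(k < n.+1) rbinom x k * ((- a) ^+ (n - k) / (n - k)`!%:R).

Definition gen_charlier (R : realType) (a N : R) (n : nat) (x : R) : R :=
  (1 + N * (-1) ^+ n * charlier a n (-1)) * charlier a n x
  - N * (-1) ^+ n * charlier a n 0 * charlier a n (x - 1).

Definition fwd_diff (R : realType) (f : R -> R) (x : R) : R := f (x + 1) - f x.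

Definition bwd_diff (R : realType) (f : R -> R) (x : R) : R := f x - f (x - 1).

(* The infinite sum is the limit of its partial sums.  When [y] is a polynomial
   function of degree [d] the terms with [d < i] vanish, so the limit exists
   and is a finite sum. *)
Definition charlier_diff_eq (R : realType) (a N : R) (k : nat -> nat)
    (b : nat -> R -> R) (n : nat) (y : R -> R) : Prop :=
  forall x : R,
    N * limn (series (fun i : nat =>
          b i x * iter (k i) (@fwd_diff R) (iter (i - k i) (@bwd_diff R) y) x))
    + x * fwd_diff (bwd_diff y) x + (a - x) * fwd_diff y x + n%:R * y x = 0.

(* Main.v *)
Require Import Defs.
From mathcomp Require Import all_boot all_order all_algebra.
From mathcomp Require Import all_classical all_reals all_analysis.
From mathcomp Require Import ring lra.

Import Order.TTheory GRing.Theory Num.Theory numFieldNormedType.Exports.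
Local Open Scope classical_set_scope.
Local Open Scope ring_scope.

(** The coefficient of [N] in the equation says that [sum_i B_i D_i C_n] at [x]
    is [- q_n (C_n(x - 1) - C_n(x - 2))] with [q_n = a^n / n!], where
    [D_i = Delta^(k_i) nabla^(i - k_i)].  At a natural number [m], duality gives
    [C_n(m) = (-a)^n / n! * P_m(n)] with [P_m] a polynomial.  If only finitely
    many [B_i] are nonzero, then for [x = m] large all shifted arguments are
    natural numbers, and dividing by [(-a)^n / n!] leaves
    [B_0(n) P_m(n) + Q_m(n) = - q_n (P_(m-1) - P_(m-2))(n)]
    with a polynomial [Q_m].  Eliminating [B_0(n)] between two consecutive [m]
    gives [A(n) = q_n W(n)] for all [n] with polynomials [A] and [W], and
    factorial growth forces [W = 0].  Since
    [P_(m+1) = P_m - a^-1 X P_m(X - 1)], this yields [P_m(-1) = P_(m+1)(-1)],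
    hence [P_m(-2) = 0], whereas [P_m] is positive on [z <= 0]. *)

(** * Binomial coefficients at a real argument *)

Lemma natrS_neq0 (R : realType) (n : nat) : n.+1%:R != 0 :> R.
Proof. by rewrite pnatr_eq0. Qed.

Lemma factr_neq0 (R : realType) (n : nat) : n`!%:R != 0 :> R.
Proof. by rewrite pnatr_eq0 -lt0n fact_gt0. Qed.

Lemma rbinom0 (R : realType) (x : R) : rbinom x 0 = 1.
Proof. by rewrite /rbinom big_ord0 fact0 divr1. Qed.

Lemma rbinomS (R : realType) (x : R) (k : nat) :
  rbinom x k.+1 * k.+1%:R = rbinom x k * (x - k%:R).
Proof.
rewrite /rbinom big_ord_recr /= factS natrM.
by field; rewrite factr_neq0 addrC natr1 natrS_neq0.
Qed.

Lemma rbinomS_shift (R : realType) (x : R) (k : nat) :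
  rbinom x k.+1 * k.+1%:R = x * rbinom (x - 1) k.
Proof.
rewrite /rbinom big_ord_recl /= factS natrM subr0.
under eq_bigr => i _ do rewrite /bump /= add1n -natr1.
under [in RHS]eq_bigr => i _ do rewrite -addrA -opprD (addrC 1).
by field; rewrite factr_neq0 addrC natr1 natrS_neq0.
Qed.

Lemma rbinom_pascal (R : realType) (x : R) (k : nat) :
  rbinom (x + 1) k.+1 = rbinom x k.+1 + rbinom x k.
Proof.
apply: (mulIf (natrS_neq0 R k)).
rewrite rbinomS_shift addrK [RHS]mulrDl rbinomS -natr1; ring.
Qed.

(** * Identities for the Charlier polynomials *)

Lemma charlier0 (R : realType) (a x : R) : charlier a 0 x = 1.
Proof. by rewrite /charlier big_ord1 rbinom0 expr0 fact0 divr1 mulr1. Qed.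

Lemma charlier_at0 (R : realType) (a : R) (n : nat) :
  charlier a n 0 = (- a) ^+ n / n`!%:R.
Proof.
rewrite /charlier big_ord_recl rbinom0 mul1r subn0 big1 ?addr0// => i _.
by rewrite /rbinom big_ord_recl /= subrr !mul0r.
Qed.

Lemma charlier_add1 (R : realType) (a x : R) (n : nat) :
  charlier a n.+1 (x + 1) = charlier a n.+1 x + charlier a n x.
Proof.
rewrite /charlier [in LHS]big_ord_recl [in X in _ = X + _]big_ord_recl !rbinom0.
rewrite -addrA -big_split /=; congr (_ + _); apply: eq_bigr => i _.
by rewrite /bump add1n subSS rbinom_pascal mulrDl.
Qed.

(** Split [n.+1] as [k + (n.+1 - k)] in each summand: the first part is absorbed by the binomial,
    the second by the factorial. *)
Lemma charlier_raise (R : realType) (a x : R) (n : nat) :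
  n.+1%:R * charlier a n.+1 x = x * charlier a n (x - 1) - a * charlier a n x.
Proof.
pose e j : R := (- a) ^+ j / j`!%:R.
have eS j : e j.+1 * j.+1%:R = - a * e j.
  rewrite /e exprS factS natrM.
  by field; rewrite factr_neq0 addrC natr1 natrS_neq0.
transitivity (\sum_(k < n.+2) k%:R * (rbinom x k * e (n.+1 - k)%N)
            + \sum_(k < n.+2) (n.+1 - k)%:R * (rbinom x k * e (n.+1 - k)%N)).
  rewrite -big_split mulr_sumr; apply: eq_bigr => k _ /=.
  by rewrite -mulrDl -natrD subnKC// -ltnS.
rewrite big_ord_recl mul0r add0r [in X in _ + X]big_ord_recr /= subnn mul0r.
rewrite addr0 /charlier !mulr_sumr -sumrN; congr (_ + _).
  apply: eq_bigr => i _; rewrite /bump add1n subSS mulrA.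
  by rewrite [_%:R * _]mulrC rbinomS_shift mulrA.
apply: eq_bigr => i _; rewrite subSn 1?leq_ord//.
by rewrite mulrCA [_%:R * _]mulrC eS mulrCA mulNr.
Qed.

Lemma charlier_eq (R : realType) (a x : R) (n : nat) :
  x * fwd_diff (bwd_diff (charlier a n)) x + (a - x) * fwd_diff (charlier a n) x
  + n%:R * charlier a n x = 0.
Proof.
case: n => [|n]; first by rewrite /fwd_diff /bwd_diff !charlier0; ring.
have h1 := charlier_add1 _ a x n.
have h2 := charlier_add1 _ a (x - 1) n.
rewrite subrK in h2.
rewrite /fwd_diff /bwd_diff addrK charlier_raise h1 h2; ring.
Qed.

(** Compared with the equation of [charlier a n] at [x - 1], the excess is
    [Delta nabla f - Delta f = - nabla f]. *)
Lemma charlier_shift_eq (R : realType) (a x : R) (n : nat) :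
  let f := fun t => charlier a n (t - 1) in
  x * fwd_diff (bwd_diff f) x + (a - x) * fwd_diff f x + n%:R * f x
  = - (charlier a n (x - 1) - charlier a n (x - 2)).
Proof.
move=> f; have := charlier_eq _ a (x - 1) n.
rewrite /f /fwd_diff /bwd_diff !addrK !subrK.
have -> : x - 1 - 1 = x - 2 by ring.
by move=> h; lra.
Qed.

(** * Duality between degree and argument *)

(** This is the Charlier polynomial of degree [m] normalized to be 1 at 0, the hypergeometric
    2F0(-m, -z; ; -1/a). The recursion is [charlier_add1] divided by [(- a) ^+ n / n!]. *)
Fixpoint dual_charlier {R : realType} (a : R) (m : nat) : {poly R} :=
  if m is m'.+1
  then dual_charlier a m' - a^-1 *: ('X * (dual_charlier a m' \Po ('X - 1)))
  else 1.

Lemma horner_dual_charlierS {R : realType} (a z : R) (m : nat) :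
  (dual_charlier a m.+1).[z] =
  (dual_charlier a m).[z] - a^-1 * z * (dual_charlier a m).[z - 1].
Proof.
by rewrite /= hornerD hornerN hornerZ hornerM hornerX horner_comp -polyC1 hornerXsubC mulrA.
Qed.

Lemma charlier_dual {R : realType} (a : R) (n m : nat) : a != 0 ->
  charlier a n m%:R = (- a) ^+ n / n`!%:R * (dual_charlier a m).[n%:R].
Proof.
move=> a0; elim: m n => [|m IH] n; first by rewrite charlier_at0 hornerC mulr1.
rewrite horner_dual_charlierS -[m.+1%:R]natr1.
case: n => [|n]; first by rewrite charlier0 mulr0 mul0r subr0 -(IH 0%N) charlier0.
rewrite charlier_add1 !IH -[n.+1%:R]natr1 addrK exprS factS natrM natr1.
by field; rewrite factr_neq0 addrC natr1 natrS_neq0 a0.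
Qed.

(** For [z <= 0] the factor [- z / a] is nonnegative and [z - 1] is again nonpositive, so the
    recursion only adds nonnegative terms. *)
Lemma dual_charlier_gt0 {R : realType} (a : R) (m : nat) (z : R) :
  0 < a -> z <= 0 -> 0 < (dual_charlier a m).[z].
Proof.
move=> a0; elim: m z => [|m IH] z z0; first by rewrite hornerC.
rewrite horner_dual_charlierS subr_gt0.
apply: (le_lt_trans _ (IH _ z0)); apply: mulr_le0_ge0.
  by rewrite mulr_ge0_le0// invr_ge0 ltW.
by apply/ltW/IH; lra.
Qed.

(** * Polynomials against factorial growth *)

Lemma poly_eq0_of_nat {R : realType} (p : {poly R}) :
  (forall n : nat, p.[n%:R] = 0) -> p = 0.
Proof.
move=> p0; apply/eqP/negPn/negP => pn0.
have := @max_poly_roots _ p [seq n%:R | n <- iota 0 (size p)] pn0.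
rewrite size_map size_iota ltnn map_inj_uniq ?iota_uniq; last exact: mulrIn (oner_neq0 _).
move=> h; suff : false by []; apply: h => //.
by apply/allP => _ /mapP[n _ ->]; rewrite /root p0.
Qed.

(* Taking quotients of consecutive values gives
   [(n + 1) A(n + 1) W(n) = a A(n) W(n + 1)], whose two sides have different
   degrees unless [A W = 0]. *)
Lemma poly_eq_exp_fact {R : realType} (a : R) (A W : {poly R}) : a != 0 ->
  (forall n : nat, A.[n%:R] = a ^+ n / n`!%:R * W.[n%:R]) -> W = 0.
Proof.
move=> a0 AW.
have q0 n : a ^+ n / n`!%:R != 0.
  by rewrite mulf_neq0 ?expf_neq0 ?invr_neq0 ?factr_neq0.
have eqAW : ('X + 1) * (A \Po ('X + 1)) * W = a *: (A * (W \Po ('X + 1))).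
  apply/eqP; rewrite -subr_eq0; apply/eqP/poly_eq0_of_nat => n.
  rewrite !(hornerD, hornerN, hornerZ, hornerM, horner_comp, hornerX, hornerC).
  rewrite natr1 !AW exprS factS natrM -natr1.
  by field; rewrite factr_neq0 natr1 natrS_neq0.
apply/eqP/negPn/negP => W0.
have A0 : A != 0.
  apply: contra W0 => /eqP A0; apply/eqP/poly_eq0_of_nat => n.
  apply: (mulfI (q0 n)); rewrite -AW A0 horner0 mulr0 //.
have sX : size ('X + 1 : {poly R}) = 2%N by rewrite -polyC1 size_XaddC.
have X0 : 'X + 1 != 0 :> {poly R} by rewrite -size_poly_eq0 sX.
have sc (p : {poly R}) : size (p \Po ('X + 1)) = size p.
  by rewrite size_comp_poly2.
have c0 (p : {poly R}) : p != 0 -> p \Po ('X + 1) != 0.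
  by rewrite -!size_poly_eq0 sc.
move: (congr1 (fun p : {poly R} => size p) eqAW).
rewrite size_scale// !size_mul ?mulf_neq0 ?c0// !sc sX.
move: A0 W0; rewrite -!size_poly_eq0.
case: (size A) (size W) => [//|m] [//|n] _ _.
by rewrite /= !addnS /= => /eqP; rewrite gtn_eqF.
Qed.

(** * The difference equation, order by order in N *)

Lemma limn_series_finite {R : realType} (u : nat -> R) (M : nat) :
  (forall i, (M <= i)%N -> u i = 0) -> limn (series u) = \sum_(i < M) u i.
Proof.
move=> u0; apply: lim_near_cst; first exact: Rhausdorff.
exists M => // n /= Mn.
rewrite /series /= (big_cat_nat (leq0n M) Mn) /= big_mkord.
rewrite -[RHS]addr0; congr (_ + _).
rewrite big_nat_cond big1// => i /andP[/andP[Mi _] _].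
exact: u0.
Qed.

Lemma iter_fwd_diff_lin {R : realType} (k : nat) (N : R) (f g : R -> R) :
  iter k (@fwd_diff R) (fun x => f x + N * g x) =
  fun x => iter k (@fwd_diff R) f x + N * iter k (@fwd_diff R) g x.
Proof.
elim: k => // k /= ->; apply/funext => x; rewrite /fwd_diff; ring.
Qed.

Lemma iter_bwd_diff_lin {R : realType} (k : nat) (N : R) (f g : R -> R) :
  iter k (@bwd_diff R) (fun x => f x + N * g x) =
  fun x => iter k (@bwd_diff R) f x + N * iter k (@bwd_diff R) g x.
Proof.
elim: k => // k /= ->; apply/funext => x; rewrite /bwd_diff; ring.
Qed.

(** One [T] serves all [n]. The bound [l <= m] keeps the arguments reached by the backward
    differences natural, so that duality applies. *)
Lemma iter_diff_charlier_dual {R : realType} (a : R) (k l m : nat) :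
  a != 0 -> (l <= m)%N ->
  exists T : {poly R}, forall n : nat,
    iter k (@fwd_diff R) (iter l (@bwd_diff R) (charlier a n)) m%:R =
    (- a) ^+ n / n`!%:R * T.[n%:R].
Proof.
move=> a0; elim: k m => [|k IH] m lm; last first.
  have [T1 hT1] := IH m.+1 (leqW lm); have [T2 hT2] := IH m lm.
  exists (T1 - T2) => n.
  by rewrite /= /fwd_diff natr1 hT1 hT2 hornerD hornerN mulrBr.
elim: l m lm => [|l IH] m lm.
  by exists (dual_charlier a m) => n; rewrite /= charlier_dual.
case: m lm => // m lm.
have [T1 hT1] := IH m.+1 (ltnW lm); have [T2 hT2] := IH m lm.
exists (T1 - T2) => n.
rewrite /= in hT1 hT2 *.
by rewrite /bwd_diff hT1 -natr1 addrK hT2 hornerD hornerN mulrBr.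
Qed.

(* Coefficient of [N] in the difference equation. *)
Lemma gen_charlier_eq_order1 {R : realType} (a : R) (k : nat -> nat)
    (b : nat -> R -> R) (n M : nat) :
  (forall i x, (M <= i)%N -> b i x = 0) ->
  (forall N, 0 < N -> charlier_diff_eq a N k b n (gen_charlier a N n)) ->
  forall x : R,
  \sum_(i < M) b i x *
     iter (k i) (@fwd_diff R) (iter (i - k i) (@bwd_diff R) (charlier a n)) x
  = - (a ^+ n / n`!%:R * (charlier a n (x - 1) - charlier a n (x - 2))).
Proof.
move=> bM Heq x.
pose p := (-1) ^+ n * charlier a n (-1); pose q := a ^+ n / n`!%:R.
(* The coefficient of [N] in [gen_charlier]; [q] equals [(-1) ^+ n * charlier a n 0]. *)
pose Q t := p * charlier a n t - q * charlier a n (t - 1).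
have genE N : gen_charlier a N n = fun t => charlier a n t + N * Q t.
  apply/funext => t; rewrite /gen_charlier /Q /p /q charlier_at0.
  have -> : a ^+ n = (-1) ^+ n * (- a) ^+ n by rewrite -exprMn mulN1r opprK.
  by ring.
have LQ : x * fwd_diff (bwd_diff Q) x + (a - x) * fwd_diff Q x + n%:R * Q x =
          q * (charlier a n (x - 1) - charlier a n (x - 2)).
  have := charlier_shift_eq _ a x n; have := charlier_eq _ a x n.
  rewrite /Q /fwd_diff /bwd_diff /= => h1 h2.
  rewrite -[_ - charlier a n (x - 2)]opprK mulrN -[RHS]add0r -(mulr0 p) -h1 -h2.
  by ring.
pose D i (f : R -> R) :=
  iter (k i) (@fwd_diff R) (iter (i - k i) (@bwd_diff R) f) x.
have E N : 0 < N ->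
    N * (\sum_(i < M) b i x * D i (charlier a n)
         + N * \sum_(i < M) b i x * D i Q)
    + N * (q * (charlier a n (x - 1) - charlier a n (x - 2))) = 0.
  move=> N0; have := Heq N N0 x; rewrite (@limn_series_finite _ _ M); last first.
    by move=> i Mi; rewrite bM// mul0r.
  rewrite -LQ genE => h; rewrite -[RHS]h -[in RHS]addrA -[in RHS]addrA.
  congr (_ + _).
    congr (_ * _); rewrite mulr_sumr -big_split; apply: eq_bigr => i _ /=.
    by rewrite iter_bwd_diff_lin iter_fwd_diff_lin /D; ring.
  have := charlier_eq _ a x n.
  rewrite /fwd_diff /bwd_diff /= => h1.
  by rewrite -[LHS]add0r -h1; ring.
(* After division by [N], [E] is affine in [N]; two values of [N] isolate its constant term. *)
have E1 := E 1 ltr01; have {E}E2 := E 2 ltac:(by []).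
rewrite -/q -[LHS]/(\sum_(i < M) b i x * D i (charlier a n)).
move: (\sum_(i < M) b i x * D i (charlier a n)) (\sum_(i < M) b i x * D i Q) E1 E2.
move: (q * (charlier a n (x - 1) - charlier a n (x - 2))) => u S T E1 E2.
lra.
Qed.

(** * Elimination of [B 0] and contradiction *)

Theorem theorem2 (R : realType) (a : R) (a_gt0 : 0 < a)
    (k : nat -> nat) (k_le : forall i : nat, (k i <= i)%N)
    (B : nat -> nat -> R -> R)
    (B0_const : forall (n : nat) (x x' : R), B 0%N n x = B 0%N n x')
    (B_indep_n : forall (i n n' : nat) (x : R),
        (1 <= i)%N -> B i n x = B i n' x)
    (B_eq : forall (N : R) (n : nat), 0 < N ->
        charlier_diff_eq a N k (fun i : nat => B i n) n (gen_charlier a N n)) :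
  infinite_set [set i : nat | exists (n : nat) (x : R), B i n x != 0].
Proof.
have a0 : a != 0 by rewrite gt_eqF.
(* [P] is kept abstract so that rewriting with [hornerD] does not unfold the
   fixpoint. *)
have [P [charlierP P0 PS P_gt0]] : exists P : nat -> {poly R},
    [/\ forall n m, charlier a n m%:R = (- a) ^+ n / n`!%:R * (P m).[n%:R],
        forall m, (P m).[0] = 1,
        forall m, P m.+1 - P m = - (a^-1 *: ('X * (P m \Po ('X - 1)))) &
        forall m z, z <= 0 -> 0 < (P m).[z] ].
  exists (dual_charlier a); split.
  - by move=> n m; exact: charlier_dual.
  - elim=> [|m IH]; first by rewrite hornerC.
    by rewrite horner_dual_charlierS IH mulr0 mul0r subr0.
  - by move=> m /=; rewrite addrC addKr.
  - by move=> m z; exact: dual_charlier_gt0.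
move=> finB.
have [M BM] : exists M, forall i n x, (M < i)%N -> B i n x = 0.
  have /finite_seqP[X hX] := finB.
  exists (\max_(i <- X) i)%N => i n x Mi.
  apply/eqP/negPn/negP => Bi.
  have : i \in X by have : [set` X] i by rewrite -hX; exists n, x.
  by move=> /(@leq_bigmax_seq _ _ xpredT id) /(_ isT); rewrite leqNgt Mi.
(* The equation at [x = m + 2]. [S] is independent of [n] because the [B i] with [i >= 1] are; they
   are taken at index 0 below. *)
have dualeq m : (M <= m.+2)%N -> exists S : {poly R}, forall n : nat,
    B 0%N n 0 * (P m.+2).[n%:R] + S.[n%:R] =
    - (a ^+ n / n`!%:R * (P m.+1 - P m).[n%:R]).
  move=> Mm.
  have /choice[T hT] : forall i : 'I_M, exists T : {poly R}, forall n,
      iter (k i.+1) (@fwd_diff R)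
        (iter (i.+1 - k i.+1) (@bwd_diff R) (charlier a n)) m.+2%:R =
      (- a) ^+ n / n`!%:R * T.[n%:R].
    move=> i; apply: iter_diff_charlier_dual => //.
    by rewrite (leq_trans (leq_subr _ _))// (leq_trans _ Mm).
  exists (\sum_(i < M) B i.+1 0%N m.+2%:R *: T i) => n.
  have w0 : (- a) ^+ n / n`!%:R != 0.
    by rewrite mulf_neq0 ?expf_neq0 ?oppr_eq0 ?invr_neq0 ?factr_neq0.
  apply: (mulfI w0).
  have := @gen_charlier_eq_order1 _ a k (fun i => B i n) n M.+1
    (fun i x Mi => BM i n x Mi) (fun N => B_eq N n) m.+2%:R.
  have k0 : k 0%N = 0%N by apply/eqP; rewrite -leqn0 k_le.
  have -> : m.+2%:R - 1 = m.+1%:R :> R by rewrite -natr1 addrK.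
  have -> : m.+2%:R - 2 = m%:R :> R by rewrite -addn2 natrD addrK.
  rewrite big_ord_recl /= k0 /= !charlierP -mulrBr => h.
  rewrite hornerD hornerN mulrN [X in _ = - X]mulrCA -h (B0_const n _ 0).
  rewrite mulrDr mulrCA.
  congr (_ + _); rewrite horner_sum mulr_sumr; apply: eq_bigr => i _.
  by rewrite hT hornerZ (B_indep_n _ n 0%N)// mulrCA.
have [S1 h1] := dualeq M (leqW (leqnSn M)).
have [S2 h2] := dualeq M.+1 (leqW (leqW (leqnSn M))).
(* What multiplies [a ^+ n / n!] when [h1] times [P M.+3] minus [h2] times [P M.+2] cancels
   [B 0]. *)
pose W := (P M.+2 - P M.+1) * P M.+2 - (P M.+1 - P M) * P M.+3.
have W0 : W = 0.
  apply: (@poly_eq_exp_fact _ a (S1 * P M.+3 - S2 * P M.+2)) => // n.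
  have {}h1 := h1 n; have {}h2 := h2 n.
  rewrite /W.
  rewrite !(hornerD, hornerN, hornerM) in h1 h2 *.
  have -> : S1.[n%:R] = - (a ^+ n / n`!%:R * ((P M.+1).[n%:R] - (P M).[n%:R]))
     - B 0%N n 0 * (P M.+2).[n%:R] by rewrite -h1 addrC addKr.
  have -> : S2.[n%:R] = - (a ^+ n / n`!%:R * ((P M.+2).[n%:R] - (P M.+1).[n%:R]))
     - B 0%N n 0 * (P M.+3).[n%:R] by rewrite -h2 addrC addKr.
  by ring.
pose sh m := P m \Po ('X - 1).
have V0 : sh M * P M.+3 - sh M.+1 * P M.+2 = 0.
  have Xa0 : a^-1 *: 'X != 0 :> {poly R}.
    by rewrite scaler_eq0 invr_eq0 negb_or a0 polyX_eq0.
  apply: (mulfI Xa0); rewrite mulr0 -W0 /W !PS -/(sh _) -/(sh _).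
  by rewrite !scalerAl; ring.
(* At 0 the shifts become values at -1 and each [P m] is 1, so [P M] and [P M.+1] agree at -1; by
   [PS] they differ there by [a^-1 * (P M).[-2] > 0]. *)
have := congr1 (fun p : {poly R} => p.[0]) V0.
rewrite hornerD hornerN !hornerM !P0 !mulr1 !horner_comp horner0.
have := congr1 (fun p : {poly R} => p.[-1]) (PS M).
rewrite !(hornerD, hornerN, hornerZ, hornerM, horner_comp, hornerX, hornerC).
rewrite sub0r.
have : 0 < a^-1 * (P M).[-1 - 1].
  by rewrite mulr_gt0 ?invr_gt0 ?P_gt0//; lra.
lra.
Qed.
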